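(* Let $\{\boldsymbol m_\tau^t,\boldsymbol\mu^t,\boldsymbol\lambda_\tau^t\}_{t\ge 0}$, $\tau\in\mathbb T$, be the sequences generated by the Bethe-ADMM algorithm (defined in the context), and let $\boldsymbol\mu^*$ be an optimal solution of the linear program $\max_{\boldsymbol\mu\in L(G)}\langle\boldsymbol\mu,\boldsymbol f\rangle$, with restrictions $\boldsymbol\mu^*_\tau$ to the trees $\tau\in\mathbb T$. Assume: (1) for every $\tau\in\mathbb T$, $\boldsymbol m_\tau^0$ and $\boldsymbol\mu_\tau^0$ are the pseudomarginals of the uniform distribution, i.e. all their node components equal $1/k$ and all their edge components equal $1/k^2$; (2) $\boldsymbol\lambda_\tau^0=0$ for every $\tau\in\mathbb T$; (3) $D_{\boldsymbol\mu}=\max_{\tau\in\mathbb T} d_\phi(\boldsymbol\mu_\tau^*\|\boldsymbol m_\tau^0)$; (4) $\alpha\ge\max_{\tau\in\mathbb T}\{\beta(2n_\tau-1)^2\}$, where $n_\tau=|V_\tau|$. For an integer $T\ge1$ let $\bar{\boldsymbol m}_\tau^T=\frac1T\sum_{t=1}^{T}\boldsymbol m_\tau^t$ and $\bar{\boldsymbol\mu}_\tau^T=\frac1T\sum_{t=1}^{T}\boldsymbol\mu_\tau^t$. Then for every $T\ge1$, $$\sum_{\tau\in\mathbb T}\left(\rho_\tau\langle\bar{\boldsymbol m}_\tau^T-\boldsymbol\mu_\tau^*,\boldsymbol\theta_\tau\rangle+\frac{\beta}{2}\|\bar{\boldsymbol m}_\tau^T-\bar{\boldsymbol\mu}_\tau^T\|_2^2\right)\le\frac{D_{\boldsymbol\mu}\,\alpha\,|\mathbb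 T|}{T}.$$
   Context: Setting. $G=(V,E)$ is a finite undirected graph and $\mathcal X=\{1,\dots,k\}$. For a graph $H=(V_H,E_H)$, the polytope $L(H)$ is the set of real vectors $\boldsymbol\mu$ with components $\mu_u(x_u)$ ($u\in V_H$, $x_u\in\mathcal X$) and $\mu_{uv}(x_u,x_v)$ ($(u,v)\in E_H$, $x_u,x_v\in\mathcal X$) such that all components are $\ge0$, $\sum_{x_u}\mu_u(x_u)=1$ for all $u\in V_H$, and for every edge $(u,v)\in E_H$: $\sum_{x_u}\mu_{uv}(x_u,x_v)=\mu_v(x_v)$ for all $x_v$ and $\sum_{x_v}\mu_{uv}(x_u,x_v)=\mu_u(x_u)$ for all $x_u$. Elements of $L(H)$ are called pseudomarginals. $\mathbb T$ is a finite collection of subgraphs $\tau=(V_\tau,E_\tau)$ of $G$ such that each $\tau$ is a tree and each node and each edge of $G$ lies in at least one $\tau\in\mathbb T$. A vector indexed by the nodes and edges of a graph $H=(V_H,E_H)$ means a real vector $\boldsymbol\mu$ with components $\mu_u(x_u)$ ($u\in V_H$, $x_u\in\mathcal X$) and $\mu_{uv}(x_u,x_v)$ ($(u,v)\in E_H$, $x_u,x_v\in\mathcal X$). For a vector $\boldsymbol\mu$ indexed by the nodes and edges of $G$, $\boldsymbol\mu_\tau$ is its restriction to the components belonging to nodes and edges of $\tau$. $\boldsymbol f$ is a real vector indexed by the nodes and edges of $G$ (the potentials). For each $\tau$, $\rho_\tau>0$ is a constant and $\boldsymbol\theta_\tau$ is a real vector indexed by the nodes and edges of $\tau$; they are chosen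 so that $\sum_{\tau\in\mathbb T}\rho_\tau\langle\boldsymbol\mu_\tau,\boldsymbol\theta_\tau\rangle=-\langle\boldsymbol\mu,\boldsymbol f\rangle$ for all $\boldsymbol\mu\in L(G)$. Bethe entropy and divergence. For $\boldsymbol m\in L(\tau)$ let $$\phi(\boldsymbol m)=-H_{Bethe}(\boldsymbol m)=\sum_{u\in V_\tau}\sum_{x_u}m_u(x_u)\log m_u(x_u)+\sum_{(u,v)\in E_\tau}\sum_{x_u,x_v}m_{uv}(x_u,x_v)\log\frac{m_{uv}(x_u,x_v)}{m_u(x_u)m_v(x_v)},$$ with natural logarithm and the convention that a term with vanishing leading factor is $0$. The same formula defines $\phi$ on vectors with strictly positive entries, where $\nabla\phi$ is its gradient. For $\boldsymbol\mu,\boldsymbol\nu\in L(\tau)$ with $\boldsymbol\nu$ strictly positive, $d_\phi(\boldsymbol\mu\|\boldsymbol\nu)=\phi(\boldsymbol\mu)-\phi(\boldsymbol\nu)-\langle\nabla\phi(\boldsymbol\nu),\boldsymbol\mu-\boldsymbol\nu\rangle$. Bethe-ADMM. Fix constants $\alpha,\beta>0$. Given initial values $\boldsymbol m_\tau^0\in L(\tau)$, $\boldsymbol\mu^0$ (a vector indexed by the nodes and edges of $G$) and $\boldsymbol\lambda_\tau^0$ (a vector indexed by the nodes and edges of $\tau$), the iteration for $t\ge0$ is: with $\mathbf y_\tau^t=\rho_\tau\boldsymbol\theta_\tau+\boldsymbol\lambda_\tau^t+\beta(\boldsymbol m_\tau^t-\boldsymbol\mu_\tau^t)$, $$\boldsymbol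 m_\tau^{t+1}=\operatorname*{argmin}_{\boldsymbol m_\tau\in L(\tau)}\langle\mathbf y_\tau^t/\alpha-\nabla\phi(\boldsymbol m_\tau^t),\boldsymbol m_\tau\rangle+\phi(\boldsymbol m_\tau)\quad(\tau\in\mathbb T),$$ $$\boldsymbol\mu^{t+1}=\operatorname*{argmin}_{\boldsymbol\mu}\sum_{\tau\in\mathbb T}\left(-\langle\boldsymbol\lambda_\tau^t,\boldsymbol\mu_\tau\rangle+\frac\beta2\|\boldsymbol m_\tau^{t+1}-\boldsymbol\mu_\tau\|_2^2\right)\quad\text{(unconstrained)},$$ $$\boldsymbol\lambda_\tau^{t+1}=\boldsymbol\lambda_\tau^t+\beta(\boldsymbol m_\tau^{t+1}-\boldsymbol\mu_\tau^{t+1})\quad(\tau\in\mathbb T).$$ *)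

(* Defs.v *)
From HB Require Import structures.
From mathcomp Require Import all_boot all_order all_algebra.
From mathcomp Require Import all_classical all_reals all_analysis.
Set Implicit Arguments.
Unset Strict Implicit.
Unset Printing Implicit Defensive.
Import Order.TTheory GRing.Theory Num.Theory.
Import numFieldNormedType.Exports.
Local Open Scope classical_set_scope.
Local Open Scope ring_scope.

(* A finite simple undirected graph whose nodes are taken from V.  Each
   undirected edge is stored exactly once, as a pair (u, v); the orientation is
   arbitrary and only fixes which of x_u, x_v is the first argument of the
   component mu_uv(x_u, x_v).  Asymmetry also excludes loops. *)
Record graph (V : finType) := Graph {
  vset : {set V};
  eset : {set V * V};
  eset_vset : forall u v, (u, v) \in eset -> (u \in vset) && (v \in vset);
  eset_asym : forall u v, (u, v) \in eset -> (v, u) \notin eset }.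

Definition subgraph (V : finType) (H G : graph V) : bool :=
  (vset H \subset vset G) && (eset H \subset eset G).

Definition adj (V : finType) (H : graph V) : rel V :=
  fun u v => ((u, v) \in eset H) || ((v, u) \in eset H).

Definition connected_graph (V : finType) (H : graph V) : Prop :=
  vset H != finset.set0 /\ {in vset H &, forall u v, connect (adj H) u v}.

Definition acyclic_graph (V : finType) (H : graph V) : Prop :=
  forall s : seq V, (2 < size s)%N -> ~~ ucycleb (adj H) s.

Definition is_tree (V : finType) (H : graph V) : Prop :=
  connected_graph H /\ acyclic_graph H.

Record tree_family (V : finType) (G : graph V) := TreeFamily {
  tree_index : finType;
  tree : tree_index -> graph V;
  tree_sub : forall i, subgraph (tree i) G;
  tree_tree : forall i, is_tree (tree i);
  tree_vcover : forall u, u \in vset G -> exists i, u \in vset (tree i);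
  tree_ecover : forall e, e \in eset G -> exists i, e \in eset (tree i) }.

Section Graph.
Variables (V : finType) (H : graph V).

Definition node : finType := {u : V | u \in vset H}.
Definition edge : finType := {e : V * V | e \in eset H}.

Fact edge_src_subproof (e : edge) : (val e).1 \in vset H.
Proof. by case: e => -[u v] /= /eset_vset /andP[]. Qed.

Fact edge_tgt_subproof (e : edge) : (val e).2 \in vset H.
Proof. by case: e => -[u v] /= /eset_vset /andP[]. Qed.

Definition src (e : edge) : node := exist _ (val e).1 (edge_src_subproof e).
Definition tgt (e : edge) : node := exist _ (val e).2 (edge_tgt_subproof e).

(* The state space is 'I_k, i.e. {0, ..., k-1} in place of {1, ..., k}. *)
Definition comp (k : nat) : finType :=
  (node * 'I_k + edge * ('I_k * 'I_k))%type.

Definition ncomp k (u : node) (x : 'I_k) : comp k := inl (u, x).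
Definition ecomp k (e : edge) (x y : 'I_k) : comp k := inr (e, (x, y)).

End Graph.

Definition gvec (R : realType) (k : nat) (V : finType) (H : graph V) :=
  {ffun comp H k -> R}.

Section Restriction.
Variables (V : finType) (H G : graph V) (sHG : subgraph H G).

Definition node_incl (u : node H) : node G :=
  exist _ (val u) (fintype.subsetP (proj1 (andP sHG)) _ (valP u)).
Definition edge_incl (e : edge H) : edge G :=
  exist _ (val e) (fintype.subsetP (proj2 (andP sHG)) _ (valP e)).

Definition comp_incl k (c : comp H k) : comp G k :=
  match c with
  | inl (u, x) => ncomp (node_incl u) x
  | inr (e, (x, y)) => ecomp (edge_incl e) x y
  end.

Definition restr (R : realType) k (mu : gvec R k G) : gvec R k H :=
  [ffun c => mu (comp_incl c)].

End Restriction.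

Section Vectors.
Variables (R : realType) (k : nat) (V : finType) (H : graph V).
Implicit Types (m mu nu : gvec R k H).

Definition dotv mu nu : R := \sum_c mu c * nu c.

Definition sqnorm mu : R := \sum_c mu c ^+ 2.

Definition local_polytope : set (gvec R k H) := [set mu |
  [/\ forall c, 0 <= mu c,
      forall u, \sum_x mu (ncomp u x) = 1,
      forall e y, \sum_x mu (ecomp e x y) = mu (ncomp (tgt e) y)
    & forall e x, \sum_y mu (ecomp e x y) = mu (ncomp (src e) x)]].

Definition uniform_marg : gvec R k H :=
  [ffun c => match c with inl _ => k%:R^-1 | inr _ => (k%:R ^+ 2)^-1 end].

(* ln and division are total, so a term with vanishing leading factor is 0. *)
Definition phi m : R :=
  \sum_u \sum_x m (ncomp u x) * ln (m (ncomp u x)) +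
  \sum_e \sum_x \sum_y m (ecomp e x y) *
    ln (m (ecomp e x y) / (m (ncomp (src e) x) * m (ncomp (tgt e) y))).

Definition unitv (c : comp H k) : gvec R k H := [ffun c' => (c' == c)%:R].

(* The vector of partial derivatives; it is the gradient of f at m when f is
   differentiable there, as phi is at every strictly positive m. *)
Definition grad (f : gvec R k H -> R) m : gvec R k H :=
  [ffun c => derive1 (fun t : R => f (m + t *: unitv c)) 0].

Definition bregman mu nu : R := phi mu - phi nu - dotv (grad phi nu) (mu - nu).

End Vectors.

Definition is_argmin (T : Type) (R : realType) (A : set T) (f : T -> R) (x : T)
  : Prop := A x /\ forall y, A y -> f x <= f y.

Definition is_max (R : realType) (I : Type) (F : I -> R) (M : R) : Prop :=
  (exists i, F i = M) /\ forall i, F i <= M.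

Definition lp_optimal (R : realType) k (V : finType) (G : graph V)
    (f mu : gvec R k G) : Prop :=
  local_polytope mu /\ forall nu, local_polytope nu -> dotv nu f <= dotv mu f.

Section Algorithm.
Variables (R : realType) (k : nat) (V : finType) (G : graph V).
Variable TT : tree_family G.

Definition treevec := forall i : tree_index TT, gvec R k (tree i).

Definition tree_restr (mu : gvec R k G) : treevec :=
  fun i => restr (tree_sub i) mu.

Definition potential_split (f : gvec R k G) (rho : tree_index TT -> R)
    (theta : treevec) : Prop :=
  forall mu, local_polytope mu ->
    \sum_i rho i * dotv (tree_restr mu i) (theta i) = - dotv mu f.

Record bethe_admm (rho : tree_index TT -> R) (theta : treevec) (alpha beta : R)
    (m : nat -> treevec) (mu : nat -> gvec R k G) (lam : nat -> treevec)
  : Prop := BetheADMM {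
  admm_init : forall i, local_polytope (m 0%N i);
  admm_m : forall t i,
    let y : gvec R k (tree i) := rho i *: theta i + lam t i
              + beta *: (m t i - tree_restr (mu t) i) in
    is_argmin (@local_polytope R k V (tree i))
      (fun z => dotv (alpha^-1 *: y - grad (@phi R k V (tree i)) (m t i)) z
                + phi z)
      (m t.+1 i);
  admm_mu : forall t,
    is_argmin setT
      (fun z : gvec R k G => \sum_i
         (- dotv (lam t i) (tree_restr z i)
          + beta / 2 * sqnorm (m t.+1 i - tree_restr z i)))
      (mu t.+1);
  admm_lam : forall t i,
    lam t.+1 i = lam t i + beta *: (m t.+1 i - tree_restr (mu t.+1) i) }.

End Algorithm.

Definition time_avg (R : realType) k (V : finType) (H : graph V)
    (v : nat -> gvec R k H) (T : nat) : gvec R k H :=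
  T%:R^-1 *: \sum_(1 <= t < T.+1) v t.

(* Main.v *)
(* The iteration is a Bregman ADMM.  Let [K_u] and [K_e] be the Kullback-Leibler
   divergences of the node and edge marginals.  On a tree the Bethe divergence is
   [sum_u K_u + sum_(e = uv) (K_e - K_u - K_v)] and [K_e >= K_u, K_v], so rooting
   the tree at a suitable node shows that it dominates each single [K_u], [K_e],
   hence [|mu - nu|^2 / (2 (2 n - 1))] by a Pinsker-type bound.  The same tree
   argument makes the slope of [phi] infinite at the boundary of the polytope, so
   every iterate is strictly positive and satisfies a variational inequality.
   Combined with the orthogonality of the multipliers and residuals to the
   consensus vectors, this gives the Lyapunov function
   [sum_tau |lambda_tau|^2 / (2 beta) + alpha d(mu*_tau, m_tau)], whose decrease
   bounds the linear gap.  The averaged residual is [lambda^T / (beta T)], so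
   the multiplier part of the last energy pays for the quadratic term. *)
Require Import Defs.
From HB Require Import structures.
From mathcomp Require Import all_boot all_order all_algebra.
From mathcomp Require Import all_classical all_reals all_analysis.
From mathcomp Require Import ring lra zify.
Import Order.TTheory GRing.Theory Num.Theory.
Import numFieldNormedType.Exports.
Local Open Scope ring_scope.

Set Implicit Arguments.
Unset Strict Implicit.
Unset Printing Implicit Defensive.

(** * Sums over the nodes and edges of a forest *)

Section Forest.
Variables (N E : finType) (s t : E -> N).
Implicit Types (S : {set E}) (A : {set N}).

(** The edge set is a parameter so that edges can be deleted while the nodes stay fixed; the
    orientation given by [s] and [t] is forgotten. *)
Definition link S : rel N := fun u v =>
  [exists e in S, ((s e == u) && (t e == v)) || ((s e == v) && (t e == u))].

Lemma link_connect_sym S : connect_sym (link S).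
Proof.
apply: sym_connect_sym => u v.
by apply: eq_existsb => e; rewrite orbC.
Qed.

Lemma link_connectS S S' u v :
  S \subset S' -> connect (link S) u v -> connect (link S') u v.
Proof.
move=> /fintype.subsetP sSS'; apply: connect_sub => a b /existsP[e /andP[eS ab]].
by apply: connect1; apply/existsP; exists e; rewrite sSS'.
Qed.

(** Acyclicity in a form that is inherited when an edge is deleted. *)
Definition bridges S :=
  forall e, e \in S -> ~~ connect (link (S :\ e)) (s e) (t e).

Lemma bridgesD1 S e : bridges S -> bridges (S :\ e).
Proof.
move=> bS e' /setD1P[e'e e'S]; apply: contra (bS _ e'S).
by apply: link_connectS; rewrite finset.setSD // subD1set.
Qed.

(* Deleting an edge separates its ends, so one of them can join [A]; repeating
   this charges every edge to its own node outside [A]. *)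
Lemma bridges_sum_ge0 (R : realDomainType) (K : N -> R) (L : E -> R) S A :
    bridges S ->
    {in A &, forall u v, connect (link S) u v -> u = v} ->
    (forall u, 0 <= K u) ->
    {in S, forall e, K (s e) <= L e /\ K (t e) <= L e} ->
  0 <= \sum_(u | u \notin A) K u + \sum_(e in S) (L e - K (s e) - K (t e)).
Proof.
move=> + + K0; move: A; have [n] := ubnP #|S|.
elim: n S => // n IHn S cS A bS sepA KL.
have [->|[e eS]] := set_0Vmem S.
  by rewrite big_set0 addr0 sumr_ge0.
have lst : connect (link S) (s e) (t e).
  by apply: connect1; apply/existsP; exists e; rewrite eS !eqxx.
(* Moving [b] into [A] uses up [K b], which cancels one node term of [e]; what remains of [e] is
   [L e] minus the term of the other end, which is nonnegative. *)
have step b : b \in [set s e; t e] -> 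
    {in A, forall u, ~~ connect (link (S :\ e)) u b} ->
    0 <= \sum_(u | u \notin A) K u + \sum_(e in S) (L e - K (s e) - K (t e)).
  move=> bst sepb.
  have bA : b \notin A by apply/negP => /sepb; rewrite connect0.
  have := IHn (S :\ e) _ (b |: A) (@bridgesD1 _ e bS).
  rewrite (cardsD1 e) eS in cS.
  move=> /(_ cS) IH.
  rewrite (bigD1 b) //= (bigD1 e) //=.
  rewrite (eq_bigl (fun u => u \notin b |: A)); last first.
    by move=> u; rewrite !inE negb_or andbC.
  rewrite (eq_bigl (fun e' => e' \in S :\ e)); last first.
    by move=> e'; rewrite !inE andbC.
  have {IH} : 0 <= \sum_(u | u \notin b |: A) K u +
      \sum_(e0 in S :\ e) (L e0 - K (s e0) - K (t e0)).
    apply: IH => [u v|e' /setD1P[_ /KL]//].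
    rewrite !inE => /predU1P[->|uA] /predU1P[->|vA] // uv.
    - by case/negP: (sepb _ vA); rewrite link_connect_sym.
    - by case/negP: (sepb _ uA).
    - by apply: sepA => //; apply: link_connectS uv; rewrite subD1set.
  have [] := KL _ eS.
  by move: bst; rewrite !inE => /orP[] /eqP ->; lra.
(* If some [a] in [A] still reaches [s e], then no [u] in [A] reaches [t e]: in [S] such a [u] would
   be joined to [a], hence equal to it, and [e] would not be a bridge. *)
have [/existsP[a /andP[aA acon]]|/existsPn nos] :=
    boolP [exists a in A, connect (link (S :\ e)) a (s e)].
  apply: (step (t e)); rewrite ?inE ?eqxx ?orbT // => u uA; apply/negP => ut.
  have S1 : S :\ e \subset S by rewrite subD1set.
  have ua : u = a.
    apply: sepA => //; apply: connect_trans (link_connectS S1 ut) _.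
    rewrite link_connect_sym; apply: connect_trans (link_connectS S1 acon) lst.
  case/negP: (bS _ eS); rewrite ua in ut; apply: connect_trans ut.
  by rewrite link_connect_sym.
apply: (step (s e)); rewrite ?inE ?eqxx // => u uA.
by have := nos u; rewrite uA.
Qed.

Section Bounds.
Variables (R : realDomainType) (K : N -> R) (L : E -> R).
Hypotheses (bT : bridges [set: E]) (K0 : forall u, 0 <= K u).
Hypothesis KL : forall e, K (s e) <= L e /\ K (t e) <= L e.

Lemma forest_sum_ge_node u :
  K u <= \sum_v K v + \sum_e (L e - K (s e) - K (t e)).
Proof.
have : 0 <= \sum_(v | v \notin [set u]) K v +
    \sum_(e in [set: E]) (L e - K (s e) - K (t e)).
  by apply: bridges_sum_ge0 => // a b /finset.set1P -> /finset.set1P ->.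
rewrite (eq_bigl (fun v => v != u)) => [|v]; last by rewrite finset.in_set1.
rewrite [X in _ + X](eq_bigl xpredT) => [|e]; last by rewrite finset.in_setT.
by rewrite [in X in _ -> X](bigD1 u) //=; lra.
Qed.

(** Deleting [e] separates its ends, so [A] can consist of both; their node terms then cancel those
    inside the term of [e], leaving [L e]. *)
Lemma forest_sum_ge_edge e :
  L e <= \sum_v K v + \sum_e (L e - K (s e) - K (t e)).
Proof.
have nc := bT (finset.in_setT e).
have st : s e != t e by apply: contra nc => /eqP ->.
have : 0 <= \sum_(v | v \notin [set s e; t e]) K v +
    \sum_(e' in [set: E] :\ e) (L e' - K (s e') - K (t e')).
  apply: bridges_sum_ge0 => //; first exact: bridgesD1.
  move=> a b /set2P[]-> /set2P[]-> // c; first by rewrite c in nc.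
  by rewrite link_connect_sym c in nc.
rewrite (eq_bigl (fun v => (v != s e) && (v != t e))) => [|v]; last first.
  by rewrite finset.in_set2 negb_or.
rewrite [X in _ + X](eq_bigl (fun e' => e' != e)) => [|e']; last by rewrite !inE andbT.
rewrite [in X in _ -> X](bigD1 (s e)) //= [in X in _ -> X](bigD1 (t e)) 1?eq_sym //=.
by rewrite [in X in _ -> X](bigD1 e) //=; lra.
Qed.

End Bounds.

(** With all weights equal to 1 the node bound reads [1 <= #|N| - #|E|]. *)
Lemma forest_card : (0 < #|N|)%N -> bridges [set: E] -> (#|N| + #|E| <= 2 * #|N| - 1)%N.
Proof.
move=> /card_gt0P[u _] bT.
have := @forest_sum_ge_node int (fun=> 1) (fun=> 1) bT (fun=> ler01)
  (fun=> conj (lexx 1) (lexx 1)) u.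
rewrite !sumr_const !cardT -!cardE subrr sub0r mulNrn !natz => H.
have : (0 < #|N|)%N by apply/card_gt0P; exists u.
lia.
Qed.

End Forest.

(** * Bethe weights on a tree *)

Section BetheWeights.
Variables (V : finType) (H : graph V).
Local Notation src := (@src V H).
Local Notation tgt := (@tgt V H).

(** A path between the ends of [e] avoiding [e], made simple, would close up with [e] to a cycle. *)
Lemma acyclic_bridges : acyclic_graph H -> bridges src tgt [set: edge H].
Proof.
move=> acH e _; apply/negP => /connectP[p0 p0P tgtE].
case/shortenP: p0P tgtE => p pP pU _ tgtE {p0}.
have eP : ((val e).1, (val e).2) \in eset H by rewrite -surjective_pairing (valP e).
have eN := eset_asym eP.
have : ~~ ucycleb (adj H) (map val (src e :: p)).
  (* The cycle has at least three nodes: no step would make [e] a loop, and one step would be a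
     second edge with the same ends, excluded by injectivity of [val] or by asymmetry. *)
  apply: acH; case: p pP pU tgtE => [|x [|//]] /=.
    move=> _ _ /(congr1 val) /= es.
    by rewrite es in eN eP; rewrite eP in eN.
  rewrite andbT => /existsP[e' /andP[/setD1P[e'e _] h]] _ tx; rewrite -tx in h.
  case/orP: h => /andP[/eqP /(congr1 val)/= h1 /eqP /(congr1 val)/= h2].
    by case/eqP: e'e; apply/val_inj; rewrite [LHS]surjective_pairing h1 h2 -surjective_pairing.
  by rewrite -h1 -h2 -surjective_pairing (valP e') in eN.
apply/negP; rewrite negbK; apply/andP; split; last by rewrite (map_inj_uniq val_inj).
rewrite /cycle map_cons rcons_path; apply/andP; split; last first.
  by rewrite (last_map val) -tgtE /adj /= eP orbT.
rewrite path_map; apply: sub_path pP => u v /existsP[e' /andP[_]].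
have e'P : ((val e').1, (val e').2) \in eset H.
  by rewrite -surjective_pairing (valP e').
rewrite /relpre /adj /=.
by case/orP => /andP[/eqP <- /eqP <-] /=; rewrite e'P ?orbT.
Qed.

Variables (R : realType) (k : nat).
Implicit Types w : Defs.comp H k -> R.

(* [phi] counts each entropy-like term [w c] of an edge once, and that of a
   node [1 - degree] times. *)
Definition bethe_wt (c : Defs.comp H k) : R :=
  match c with
  | inl (u, _) => 1 - \sum_e ((src e == u)%:R + (tgt e == u)%:R)
  | inr _ => 1
  end.

Definition nodesum w (u : node H) := \sum_x w (ncomp u x).
Definition edgesum w (e : edge H) := \sum_x \sum_y w (ecomp e x y).

Lemma sum_comp w : \sum_c w c = \sum_u nodesum w u + \sum_e edgesum w e.
Proof.
rewrite big_sumType /=; congr (_ + _); rewrite /nodesum /edgesum.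
  by rewrite pair_bigA; apply: eq_bigr => -[].
rewrite [LHS](eq_bigr (fun c => w (inr (c.1, c.2)))); last by case.
rewrite -(pair_bigA _ (fun e xy => w (inr (e, xy)))) /=.
apply: eq_bigr => e _; rewrite pair_bigA; by apply: eq_bigr => -[].
Qed.

(** Counting incidences edge by edge instead of node by node gives the shape that the forest bounds
    control. *)
Lemma bethe_sumE w : \sum_c bethe_wt c * w c =
  \sum_u nodesum w u +
  \sum_e (edgesum w e - nodesum w (src e) - nodesum w (tgt e)).
Proof.
rewrite sum_comp.
have -> : \sum_u nodesum (fun c => bethe_wt c * w c) u =
    \sum_u nodesum w u - \sum_e (nodesum w (src e) + nodesum w (tgt e)).
  transitivity (\sum_u (nodesum w u -
      \sum_e ((src e == u)%:R * nodesum w u + (tgt e == u)%:R * nodesum w u))).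
    apply: eq_bigr => u _; rewrite {1}/nodesum /= -mulr_sumr -/(nodesum w u) mulrBl mul1r.
    by rewrite mulr_suml; congr (_ - _); apply: eq_bigr => e _; rewrite mulrDl.
  rewrite sumrB; congr (_ - _); rewrite exchange_big /=; apply: eq_bigr => e _.
  rewrite big_split /= (bigD1 (src e)) //= eqxx mul1r big1 => [|i]; last first.
    by rewrite eq_sym => /negbTE ->; rewrite mul0r.
  rewrite (bigD1 (tgt e)) //= eqxx mul1r big1 => [|i]; last first.
    by rewrite eq_sym => /negbTE ->; rewrite mul0r.
  by rewrite !addr0.
rewrite -addrA -sumrN -big_split /=; congr (_ + _); apply: eq_bigr => e _.
have -> : edgesum (fun c => bethe_wt c * w c) e = edgesum w e.
  by apply: eq_bigr => x _; apply: eq_bigr => y _; rewrite mul1r.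
ring.
Qed.

Lemma bethe_sum_ge_node w u : acyclic_graph H ->
    (forall u, 0 <= nodesum w u) ->
    (forall e, nodesum w (src e) <= edgesum w e) ->
    (forall e, nodesum w (tgt e) <= edgesum w e) ->
  nodesum w u <= \sum_c bethe_wt c * w c.
Proof.
by move=> /acyclic_bridges bH *; rewrite bethe_sumE forest_sum_ge_node.
Qed.

Lemma bethe_sum_ge_edge w e : acyclic_graph H ->
    (forall u, 0 <= nodesum w u) ->
    (forall e, nodesum w (src e) <= edgesum w e) ->
    (forall e, nodesum w (tgt e) <= edgesum w e) ->
  edgesum w e <= \sum_c bethe_wt c * w c.
Proof.
by move=> /acyclic_bridges bH *; rewrite bethe_sumE forest_sum_ge_edge.
Qed.

End BetheWeights.

(** * Logarithmic inequalities and derivatives *)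

Section LogInequalities.
Variable R : realType.

Lemma mulr_lnB_le (a y : R) : 0 <= a -> 0 < y -> a * (ln y - ln a) <= y - a.
Proof.
rewrite le_eqVlt => /predU1P[<- y0|a0 y0].
  by rewrite mul0r subr0 ltW.
have ya : 0 < y / a by rewrite divr_gt0.
rewrite -ln_div ?posrE // mulrC -ler_pdivlMr // mulrBl divff ?gt_eqF //.
have := @le_ln1Dx R (y / a - 1); rewrite (_ : 1 + (y / a - 1) = y / a); last by ring.
by apply; rewrite ltrBrDl subrr.
Qed.

(** The log-sum inequality: [mulr_lnB_le] is applied termwise at [y = b i * (A / B)], and the linear
    corrections sum to zero. *)
Lemma log_sum_le (I : finType) (a b : I -> R) :
  (forall i, 0 <= a i) -> (forall i, 0 < b i) ->
  (\sum_i a i) * (ln (\sum_i a i) - ln (\sum_i b i)) <=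
    \sum_i a i * (ln (a i) - ln (b i)).
Proof.
move=> a0 b0; set A := \sum_i a i; set B := \sum_i b i.
have [A0|/eqP A0] := pselect (A = 0).
  have az i : a i = 0 by have := psumr_eq0P (fun i _ => a0 i) A0 => ->.
  by rewrite A0 mul0r big1 // => i _; rewrite az mul0r.
have Apos : 0 < A by rewrite lt_def A0 sumr_ge0.
have Bpos : 0 < B.
  rewrite lt_def sumr_ge0 ?andbT; last by move=> i _; exact: ltW.
  apply/eqP => /psumr_eq0P B0; case/eqP: A0; apply: big1 => i _.
  by have := b0 i; rewrite B0 ?ltxx // => j _; exact: ltW.
have -> : A * (ln A - ln B) =
    \sum_i (a i * (ln A - ln B) + (a i - b i * (A / B))).
  rewrite big_split /= -mulr_suml sumrB -mulr_suml -/A -/B.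
  by rewrite mulrCA divff ?gt_eqF // mulr1 subrr addr0.
apply: ler_sum => i _.
have y0 : 0 < b i * (A / B) by rewrite mulr_gt0 ?divr_gt0.
have := mulr_lnB_le (a0 i) y0.
rewrite lnM ?posrE ?divr_gt0 // ln_div ?posrE //; lra.
Qed.

Lemma lnB_ge (x b : R) : 0 < b -> b <= x -> x <= 1 -> x - b <= ln x - ln b.
Proof.
move=> b0 bx x1; have x0 := lt_le_trans b0 bx.
have H := mulr_lnB_le (ltW x0) b0.
have L : 0 <= ln x - ln b by rewrite subr_ge0 ler_ln.
have : x * (ln x - ln b) <= ln x - ln b by rewrite ler_piMl.
lra.
Qed.

(** Pointwise Pinsker-type bound. As a function of [a], the difference of the two sides is minimal
    at [b], because its derivative [dF] has the sign of [x - b] by [lnB_ge]. *)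
Lemma sqr_le_kl (a b : R) : 0 <= a -> a <= 1 -> 0 < b -> b <= 1 ->
  2^-1 * (a - b) ^+ 2 <= a * (ln a - ln b) - a + b.
Proof.
rewrite le_eqVlt => /predU1P[<-|a0] a1 b0 b1; first by nra.
pose F (x : R) := x * (ln x - ln b) - x - 2^-1 * (x - b) ^+ 2.
pose dF (x : R) := ln x - ln b - (x - b).
have Fd (x : R) : 0 < x -> is_derive x 1 F (dF x).
  move=> x0; have ? := is_derive1_ln x0.
  apply: is_derive_eq; rewrite /GRing.scale /= /dF.
  by field; rewrite gt_eqF.
have Fc (x y : R) : 0 < x -> ({within `[x, y], continuous F})%classic.
  move=> x0; apply: derivable_within_continuous => z.
  rewrite in_itv /= => /andP[xz _].
  by have [] := Fd z (lt_le_trans x0 xz).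
suff : F b <= F a by rewrite /F subrr; lra.
have [ab|ba] := leP a b.
  have [||c] := @MVT_segment R F dF a b ab; last 1 first.
  - rewrite in_itv /= => /andP[ac cb] E; rewrite -subr_le0 E.
    rewrite mulr_le0_ge0 ?subr_ge0 // /dF.
    by have := @lnB_ge b c (lt_le_trans a0 ac) cb b1; lra.
  - by move=> x; rewrite in_itv /= => /andP[/(lt_trans a0) /Fd].
  - exact: Fc.
have [||c] := @MVT_segment R F dF b a (ltW ba); last 1 first.
- rewrite in_itv /= => /andP[bc ca] E; rewrite -subr_ge0 E.
  rewrite mulr_ge0 ?subr_ge0 ?(ltW ba) // /dF.
  by have := @lnB_ge c b b0 bc (le_trans ca a1); lra.
- by move=> x; rewrite in_itv /= => /andP[/(lt_trans b0) /Fd].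
- exact: Fc.
Qed.

(** * Derivatives along affine lines *)

Lemma continuous_is_derive (f : R -> R) (x df : R) :
  is_derive x 1 f df -> {for x, continuous f}.
Proof.
by case=> fd _; apply: differentiable_continuous; exact/derivable1_diffP.
Qed.

Lemma is_derive_bigsum (I : Type) (r : seq I) (P : pred I)
    (F : I -> R -> R) (dF : I -> R) (x : R) :
  (forall i, is_derive x 1 (F i) (dF i)) ->
  is_derive x 1 (fun t => \sum_(i <- r | P i) F i t) (\sum_(i <- r | P i) dF i).
Proof.
move=> FdF; elim: r => [|i r IHr].
  rewrite big_nil (_ : (fun _ => _) = cst 0); first exact: is_derive_cst.
  by apply/funext => t; rewrite big_nil.
rewrite big_cons (_ : (fun _ => _) = if P i then
    F i + (fun t => \sum_(j <- r | P j) F j t) else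
    (fun t => \sum_(j <- r | P j) F j t)); last first.
  by apply/funext => t; rewrite big_cons; case: (P i).
by case: (P i) => //; exact: is_deriveD.
Qed.

Lemma is_derive_affine (a b x : R) : is_derive x 1 (fun t : R => a + t * b) b.
Proof.
by apply: is_derive_eq; rewrite /GRing.scale /=; ring.
Qed.

Lemma is_derive_ln_affine (a b g : R) : 0 < a ->
  is_derive (0 : R) 1 (fun t : R => g * ln (a + t * b)) (g * (b / a)).
Proof.
move=> a0; have ? := is_derive_affine a b 0.
have ? : is_derive (0 : R) 1 (fun t : R => ln (a + t * b)) (b / a).
  have ? : is_derive (a + 0 * b) 1 (@ln R) a^-1.
    by rewrite mul0r addr0; exact: is_derive1_ln.
  have := @is_derive1_comp R (@ln R) (fun t => a + t * b) 0.
  by move=> h; apply: is_derive_eq; rewrite mulrC.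
by apply: is_derive_eq; rewrite /GRing.scale /=; ring.
Qed.

Lemma is_derive_xlnx (a b : R) : 0 < a ->
  is_derive (0 : R) 1 (fun t : R => (a + t * b) * ln (a + t * b)) (b * ln a + b).
Proof.
move=> a0; have ? := is_derive_affine a b 0.
have := is_derive_ln_affine b 1 a0; under eq_fun do rewrite mul1r.
rewrite mul1r => ?.
apply: is_derive_eq; rewrite /GRing.scale /= !mul0r !addr0.
by field; rewrite gt_eqF.
Qed.

Lemma is_derive_mutual (a b a1 b1 a2 b2 : R) : 0 < a -> 0 < a1 -> 0 < a2 ->
  is_derive (0 : R) 1 (fun t : R => (a + t * b) *
      ln ((a + t * b) / ((a1 + t * b1) * (a2 + t * b2))))
    (b * ln (a / (a1 * a2)) + b - a / a1 * b1 - a / a2 * b2).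
Proof.
move=> a0 a10 a20; have ? := is_derive_affine a b 0.
have ? := is_derive_affine a1 b1 0; have ? := is_derive_affine a2 b2 0.
pose q (t : R) := (a + t * b) / ((a1 + t * b1) * (a2 + t * b2)).
have q0 : 0 < q 0 by rewrite /q !mul0r !addr0 divr_gt0 ?mulr_gt0.
have ? := is_derive1_ln q0.
have n1 : ((a1 + 0 * b1) * (a2 + 0 * b2)) != 0.
  by rewrite !mul0r !addr0 mulf_neq0 ?gt_eqF.
have ? := @is_deriveV R (fun t => (a1 + t * b1) * (a2 + t * b2)) 0 _ 1 n1 _.
have : is_derive (0 : R) 1 q (b / (a1 * a2) - a / (a1 * a2) * (b1 / a1 + b2 / a2)).
  apply: is_derive_eq; rewrite /GRing.scale /= !mul0r !addr0.
  by field; rewrite !gt_eqF.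
move=> ?; have ? := @is_derive1_comp R (@ln R) q 0 _ _ _ _.
apply: is_derive_eq; rewrite /GRing.scale /= /q !mul0r !addr0.
by field; rewrite !gt_eqF.
Qed.

End LogInequalities.

(** * The Bethe entropy and its gradient *)

Section BetheEntropy.
Variables (R : realType) (k : nat) (V : finType) (H : graph V).
Local Notation vec := (gvec R k H).
Local Notation src := (@src V H).
Local Notation tgt := (@tgt V H).
Implicit Types (m mu nu d w : vec).

(** The homogeneous constraints of the polytope, shared by its points and by differences of two of
    its points. *)
Definition consistent d :=
  (forall e y, \sum_x d (ecomp e x y) = d (ncomp (tgt e) y)) /\
  (forall e x, \sum_y d (ecomp e x y) = d (ncomp (src e) x)).

Lemma polytope_consistent m : local_polytope m -> consistent m.
Proof. by case. Qed.

Lemma polytopeB_consistent mu nu :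
  local_polytope mu -> local_polytope nu -> consistent (mu - nu).
Proof.
move=> [_ _ t1 s1] [_ _ t2 s2]; split=> e x.
  by under eq_bigr do rewrite !ffunE; rewrite sumrB t1 t2 !ffunE.
by under eq_bigr do rewrite !ffunE; rewrite sumrB s1 s2 !ffunE.
Qed.

Lemma sum_ecomp_src d g e : consistent d ->
  \sum_x \sum_y d (ecomp e x y) * g x = \sum_x d (ncomp (src e) x) * g x.
Proof. by move=> [_ dS]; apply: eq_bigr => x _; rewrite -mulr_suml dS. Qed.

Lemma sum_ecomp_tgt d g e : consistent d ->
  \sum_x \sum_y d (ecomp e x y) * g y = \sum_y d (ncomp (tgt e) y) * g y.
Proof.
move=> [dT _]; rewrite exchange_big; apply: eq_bigr => y _.
by rewrite -mulr_suml dT.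
Qed.

Lemma polytope_node_ge m e x y : local_polytope m ->
  m (ecomp e x y) <= m (ncomp (src e) x) /\ m (ecomp e x y) <= m (ncomp (tgt e) y).
Proof.
move=> [m0 _ mt ms]; split; [rewrite -ms (bigD1 y)|rewrite -mt (bigD1 x)] => //=;
by rewrite lerDl sumr_ge0.
Qed.

Lemma polytope_le1 m c : local_polytope m -> m c <= 1.
Proof.
move=> Lm; have [m0 m1 _ _] := Lm.
have n1 u x : m (inl (u, x)) <= 1.
  by rewrite -(m1 u) (bigD1 x) //= lerDl sumr_ge0.
case: c => [[u x]//|[e [x y]]].
by have [mle _] := polytope_node_ge e x y Lm; apply: le_trans mle (n1 _ _).
Qed.

(** Consistency turns the node logarithms inside the edge terms into node sums, one for each
    incidence. *)
Lemma phi_polytopeE m : local_polytope m ->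
  phi m = \sum_c bethe_wt R c * (m c * ln (m c)).
Proof.
move=> Lm; have [m0 _ _ _] := Lm; rewrite bethe_sumE; congr (_ + _).
apply: eq_bigr => e _; rewrite /nodesum.
rewrite -(sum_ecomp_src (fun x => ln (m (ncomp (src e) x))) e (polytope_consistent Lm)).
rewrite -(sum_ecomp_tgt (fun x => ln (m (ncomp (tgt e) x))) e (polytope_consistent Lm)).
rewrite /edgesum -!sumrB; apply: eq_bigr => x _; rewrite -!sumrB.
(* A zero edge entry kills every term; a positive one makes both node marginals positive, so the
   logarithm splits. *)
apply: eq_bigr => y _; have [|/eqP mp] := eqVneq (m (ecomp e x y)) 0.
  by move=> ->; rewrite !mul0r !subr0.
have {}mp : 0 < m (ecomp e x y) by rewrite lt_def m0 andbT; exact/eqP.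
have [ms mt] := polytope_node_ge e x y Lm.
have {}ms := lt_le_trans mp ms; have {}mt := lt_le_trans mp mt.
by rewrite ln_div ?posrE ?mulr_gt0 // lnM ?posrE //; ring.
Qed.

(** The directional derivative of [phi], for arbitrary [d]: the unit vectors used by [grad] do not
    respect the polytope constraints. *)
Definition dphi m d : R :=
  \sum_u \sum_x (d (ncomp u x) * ln (m (ncomp u x)) + d (ncomp u x)) +
  \sum_e \sum_x \sum_y
    (d (ecomp e x y) *
       ln (m (ecomp e x y) / (m (ncomp (src e) x) * m (ncomp (tgt e) y)))
     + d (ecomp e x y)
     - m (ecomp e x y) / m (ncomp (src e) x) * d (ncomp (src e) x)
     - m (ecomp e x y) / m (ncomp (tgt e) y) * d (ncomp (tgt e) y)).

Lemma is_derive_phi m d : (forall c, 0 < m c) ->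
  is_derive (0 : R) 1 (fun t : R => phi (m + t *: d)) (dphi m d).
Proof.
move=> m0.
rewrite (_ : (fun _ => _) =
   (fun t : R => \sum_u \sum_x (m (ncomp u x) + t * d (ncomp u x)) *
       ln (m (ncomp u x) + t * d (ncomp u x))) +
   (fun t : R => \sum_e \sum_x \sum_y (m (ecomp e x y) + t * d (ecomp e x y)) *
       ln ((m (ecomp e x y) + t * d (ecomp e x y)) /
          ((m (ncomp (src e) x) + t * d (ncomp (src e) x)) *
          (m (ncomp (tgt e) y) + t * d (ncomp (tgt e) y)))))).
  apply: is_deriveD.
    apply: is_derive_bigsum => u; apply: is_derive_bigsum => x.
    exact: is_derive_xlnx.
  apply: is_derive_bigsum => e; apply: is_derive_bigsum => x.
  apply: is_derive_bigsum => y; exact: is_derive_mutual.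
apply/funext => t; rewrite /phi; congr (_ + _).
  by apply: eq_bigr => u _; apply: eq_bigr => x _; rewrite !ffunE.
by apply: eq_bigr => e _; apply: eq_bigr => x _; apply: eq_bigr => y _; rewrite !ffunE.
Qed.

Lemma dphi_linear m a d w : dphi m (a *: d + w) = a * dphi m d + dphi m w.
Proof.
rewrite /dphi mulrDr addrACA; congr (_ + _);
  rewrite mulr_sumr -big_split; apply: eq_bigr => i _;
  rewrite mulr_sumr -big_split; apply: eq_bigr => x _ /=.
  by rewrite !ffunE /GRing.scale /=; ring.
rewrite mulr_sumr -big_split; apply: eq_bigr => y _ /=.
by rewrite !ffunE /GRing.scale /=; ring.
Qed.

Lemma dphi0 m : dphi m 0 = 0.
Proof. by have := dphi_linear m 1 0 0; rewrite scaler0 addr0; lra. Qed.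

Lemma unitv_sum d : d = \sum_c d c *: unitv R c.
Proof.
apply/ffunP => c; rewrite sum_ffunE (bigD1 c) //= big1 => [|c' /negbTE cc'].
  by rewrite !ffunE eqxx /GRing.scale /= mulr1 addr0.
by rewrite !ffunE eq_sym cc' scaler0.
Qed.

Lemma dotv_grad_phi m d : (forall c, 0 < m c) ->
  dotv (grad (@phi R k V H) m) d = dphi m d.
Proof.
move=> m0; rewrite [in RHS](unitv_sum d) /dotv.
have -> : forall r, dphi m (\sum_(c <- r) d c *: unitv R c) =
    \sum_(c <- r) d c * dphi m (unitv R c).
  elim=> [|c r IHr]; first by rewrite !big_nil dphi0.
  by rewrite !big_cons dphi_linear IHr.
apply: eq_bigr => c _; rewrite mulrC ffunE derive1E; congr (_ * _).
by have ? := is_derive_phi (unitv R c) m0; rewrite derive_val.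
Qed.

(** Along directions tangent to the polytope all non-logarithmic terms of [dphi] sum to zero. *)
Lemma dotv_grad_phiE m d : local_polytope m -> (forall c, 0 < m c) ->
    consistent d -> (forall u, \sum_x d (ncomp u x) = 0) ->
  dotv (grad (@phi R k V H) m) d = \sum_c bethe_wt R c * (d c * ln (m c)).
Proof.
move=> Lm m0 cd d0; rewrite dotv_grad_phi // bethe_sumE /dphi; congr (_ + _).
  by apply: eq_bigr => u _; rewrite big_split /= d0 addr0.
have [_ _ mt ms] := Lm; have [dt ds] := cd.
apply: eq_bigr => e _; rewrite /nodesum.
rewrite -(sum_ecomp_src (fun x => ln (m (ncomp (src e) x))) e cd).
rewrite -(sum_ecomp_tgt (fun x => ln (m (ncomp (tgt e) x))) e cd).
have ed0 : \sum_x \sum_y d (ecomp e x y) = 0.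
  by under eq_bigr do rewrite ds; rewrite d0.
have es0 : \sum_x \sum_y m (ecomp e x y) / m (ncomp (src e) x) *
    d (ncomp (src e) x) = 0.
  rewrite -[RHS](d0 (src e)); apply: eq_bigr => x _.
  by rewrite -mulr_suml -mulr_suml ms divff ?mul1r // gt_eqF.
have et0 : \sum_x \sum_y m (ecomp e x y) / m (ncomp (tgt e) y) *
    d (ncomp (tgt e) y) = 0.
  rewrite exchange_big -[RHS](d0 (tgt e)); apply: eq_bigr => x _.
  by rewrite -mulr_suml -mulr_suml mt divff ?mul1r // gt_eqF.
transitivity (\sum_x \sum_y d (ecomp e x y) *
      ln (m (ecomp e x y) / (m (ncomp (src e) x) * m (ncomp (tgt e) y)))
    + \sum_x \sum_y d (ecomp e x y)
    - \sum_x \sum_y m (ecomp e x y) / m (ncomp (src e) x) * d (ncomp (src e) x)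
    - \sum_x \sum_y m (ecomp e x y) / m (ncomp (tgt e) y) * d (ncomp (tgt e) y)).
  rewrite -big_split -!sumrB /=; apply: eq_bigr => x _.
  by rewrite -big_split -!sumrB.
rewrite ed0 es0 et0 addr0 !subr0 /edgesum -!sumrB; apply: eq_bigr => x _.
rewrite -!sumrB; apply: eq_bigr => y _.
by rewrite ln_div ?posrE ?mulr_gt0 // lnM ?posrE //; ring.
Qed.

Lemma polytopeB_sum0 mu nu u : local_polytope mu -> local_polytope nu ->
  \sum_x (mu - nu) (ncomp u x) = 0.
Proof.
move=> [_ m1 _ _] [_ n1 _ _]; under eq_bigr do rewrite !ffunE.
by rewrite sumrB m1 n1 subrr.
Qed.

Lemma bregmanE mu nu :
    local_polytope mu -> local_polytope nu -> (forall c, 0 < nu c) ->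
  bregman mu nu = \sum_c bethe_wt R c * (mu c * (ln (mu c) - ln (nu c))).
Proof.
move=> Lm Ln n0; rewrite /bregman !phi_polytopeE // dotv_grad_phiE //; last 2 first.
- exact: polytopeB_consistent.
- by move=> u; exact: polytopeB_sum0.
rewrite -!sumrB; apply: eq_bigr => c _; rewrite !ffunE; ring.
Qed.

End BetheEntropy.

(** * Strong convexity of the Bethe divergence *)

Section BetheDivergence.
Variables (R : realType) (k : nat) (V : finType) (H : graph V).
Local Notation vec := (gvec R k H).
Local Notation src := (@src V H).
Local Notation tgt := (@tgt V H).
Implicit Types (mu nu : vec).

Section Bounds.
Variables (mu nu : vec).
Hypotheses (Lmu : local_polytope mu) (Lnu : local_polytope nu).
Hypothesis nu_gt0 : forall c, 0 < nu c.

Let kl c := mu c * (ln (mu c) - ln (nu c)).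

Lemma kl_node_ge0 u : 0 <= nodesum kl u.
Proof.
have [mu0 mu1 _ _] := Lmu; have [_ nu1 _ _] := Lnu.
apply: le_trans (log_sum_le (fun x => mu0 (ncomp u x)) (fun x => nu_gt0 (ncomp u x))).
by rewrite mu1 nu1 subrr mulr0.
Qed.

(** Marginalization cannot increase the Kullback-Leibler divergence: this is the log-sum inequality
    on each fibre. *)
Lemma kl_src_le_edge e : nodesum kl (src e) <= edgesum kl e.
Proof.
have [mu0 _ _ mus] := Lmu; have [_ _ _ nus] := Lnu.
apply: ler_sum => x _; rewrite /kl -mus -nus.
exact: (log_sum_le (fun y => mu0 (ecomp e x y)) (fun y => nu_gt0 (ecomp e x y))).
Qed.

Lemma kl_tgt_le_edge e : nodesum kl (tgt e) <= edgesum kl e.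
Proof.
have [mu0 _ mut _] := Lmu; have [_ _ nut _] := Lnu.
rewrite /edgesum exchange_big; apply: ler_sum => y _; rewrite /kl -mut -nut.
exact: (log_sum_le (fun x => mu0 (ecomp e x y)) (fun x => nu_gt0 (ecomp e x y))).
Qed.

(** Equal masses cancel the linear terms of [sqr_le_kl]. *)
Lemma sqr_sum_le_kl (I : finType) (f : I -> Defs.comp H k) :
  \sum_i mu (f i) = \sum_i nu (f i) ->
  2^-1 * \sum_i (mu (f i) - nu (f i)) ^+ 2 <= \sum_i kl (f i).
Proof.
move=> munu; have [mu0 _ _ _] := Lmu.
have -> : \sum_i kl (f i) = \sum_i (kl (f i) - mu (f i) + nu (f i)).
  by rewrite big_split sumrB /= munu subrK.
rewrite mulr_sumr; apply: ler_sum => i _.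
by apply: sqr_le_kl; rewrite ?polytope_le1.
Qed.

Lemma polytope_edge_sum1 (m : vec) e : local_polytope m -> \sum_p m (ecomp e p.1 p.2) = 1.
Proof.
move=> [_ m1 _ ms]; rewrite -(pair_bigA _ (fun x y => m (ecomp e x y))) /=.
by under eq_bigr do rewrite ms; exact: m1.
Qed.

Hypothesis acH : acyclic_graph H.

Lemma bregman_ge_node u :
  2^-1 * nodesum (fun c => (mu c - nu c) ^+ 2) u <= bregman mu nu.
Proof.
have [_ mu1 _ _] := Lmu; have [_ nu1 _ _] := Lnu.
apply: le_trans (sqr_sum_le_kl _) _; first by rewrite mu1 nu1.
rewrite bregmanE //; apply: (bethe_sum_ge_node (w := kl)) => //.
- exact: kl_node_ge0.
- exact: kl_src_le_edge.
- exact: kl_tgt_le_edge.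
Qed.

Lemma bregman_ge_edge e :
  2^-1 * edgesum (fun c => (mu c - nu c) ^+ 2) e <= bregman mu nu.
Proof.
rewrite /edgesum pair_bigA /=.
apply: le_trans (sqr_sum_le_kl (f := fun p => ecomp e p.1 p.2) _) _.
  by rewrite !polytope_edge_sum1.
rewrite -(pair_bigA _ (fun x y => kl (ecomp e x y))) bregmanE //=.
apply: (bethe_sum_ge_edge (w := kl)) => //.
- exact: kl_node_ge0.
- exact: kl_src_le_edge.
- exact: kl_tgt_le_edge.
Qed.

End Bounds.

Lemma bregman_ge0 mu nu : is_tree H ->
    local_polytope mu -> local_polytope nu -> (forall c, 0 < nu c) ->
  0 <= bregman mu nu.
Proof.
move=> [[/set0Pn[u uH] _] acH] Lmu Lnu nu0.
apply: le_trans (bregman_ge_node Lmu Lnu nu0 acH (exist _ u uH)).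
by rewrite mulr_ge0 // sumr_ge0 // => x _; exact: sqr_ge0.
Qed.

Lemma card_node : #|node H| = #|vset H|.
Proof. by rewrite card_sig; apply: eq_card. Qed.

(* The Bethe divergence dominates the Kullback-Leibler divergence of each of
   the [2 n - 1] marginals. *)
Lemma sqnorm_le_bregman mu nu : is_tree H ->
    local_polytope mu -> local_polytope nu -> (forall c, 0 < nu c) ->
  2^-1 * sqnorm (mu - nu) <= (2 * #|vset H|%:R - 1) * bregman mu nu.
Proof.
move=> treeH Lmu Lnu nu0; have [[/set0Pn[u uH] _] acH] := treeH.
have nH : (0 < #|node H|)%N by apply/card_gt0P; exists (exist _ u uH).
have cH := forest_card nH (acyclic_bridges acH).
have B0 := bregman_ge0 treeH Lmu Lnu nu0.
have -> : sqnorm (mu - nu) = \sum_c (mu c - nu c) ^+ 2.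
  by apply: eq_bigr => c _; rewrite !ffunE.
rewrite sum_comp mulrDr !mulr_sumr.
apply: (@le_trans _ _ (\sum_(v : node H) bregman mu nu + \sum_(e : edge H) bregman mu nu)).
  apply: lerD; apply: ler_sum => i _; first exact: bregman_ge_node.
  exact: bregman_ge_edge.
rewrite !sumr_const -mulrnDr -[leLHS]mulr_natl ler_wpM2r // -card_node.
rewrite -natrM -[X in _ - X]/(1%:R) -natrB; last by lia.
by rewrite ler_nat.
Qed.

End BetheDivergence.

(** * Minimizers over the local polytope *)

Section MirrorStep.
Variable R : realType.

Lemma lt_right_of_continuous (f : R -> R) (M : R) :
  {for 0, continuous f} -> f 0 < M ->
  exists2 e, 0 < e & forall t, 0 < t -> t < e -> f t < M.
Proof.
move=> fc fM.
have : \forall t \near (0 : R), f t < M by exact: (@cvgr_lt R R (nbhs 0) _ f (f 0) fc).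
move=> /nbhs_ballP[e /= e0 he]; exists e => // t t0 te; apply: he.
by rewrite /ball /= sub0r normrN gtr0_norm.
Qed.

Lemma ge0_right_limit (f : R -> R) : {for 0, continuous f} ->
  (forall t, 0 < t -> t < 1 -> 0 <= f t) -> 0 <= f 0.
Proof.
move=> fc f0; rewrite leNgt; apply/negP => /(lt_right_of_continuous fc)[e e0 fe].
pose t := Num.min (e / 2) (2^-1 : R).
have t0 : 0 < t by rewrite lt_min invr_gt0 ltr0n divr_gt0.
have te : t < e by rewrite gt_min; apply/orP; left; lra.
have t1 : t < 1 by rewrite gt_min; apply/orP; right; lra.
by have := f0 t t0 t1; rewrite leNgt fe.
Qed.

Lemma ln_dominates (f : R -> R) (B : R) : {for 0, continuous f} -> 0 < B ->
  exists t, [/\ 0 < t, t < 1 & B * ln t + f t < 0].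
Proof.
move=> fc B0; have M0 : f 0 < `|f 0| + 1 by rewrite ltr_pwDr ?ler_norm.
have [e e0 fe] := lt_right_of_continuous fc M0.
(* For [t <= s] the logarithmic term is at most [- (|f 0| + 1)], while [f t] stays below [|f 0| + 1]
   for [t < e]. *)
pose s := expR (- ((`|f 0| + 1) / B)); pose t := Num.min (e / 2) (Num.min s 2^-1).
have t0 : 0 < t by rewrite !lt_min invr_gt0 ltr0n divr_gt0 // expR_gt0.
have te : t < e by rewrite gt_min; apply/orP; left; lra.
have ts : t <= s by rewrite !ge_min lexx orbT.
exists t; split => //; first by rewrite !gt_min; apply/orP; right; apply/orP; right; lra.
have lt : ln t <= - ((`|f 0| + 1) / B) by rewrite -[leRHS]expRK ler_ln ?posrE ?expR_gt0.
have : B * ln t <= - (`|f 0| + 1).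
  apply: le_trans (ler_wpM2l (ltW B0) lt) _.
  by rewrite mulrN mulrCA divff ?mulr1 // gt_eqF.
have := fe t t0 te; lra.
Qed.

Variables (k : nat) (V : finType) (H : graph V).
Local Notation vec := (gvec R k H).
Local Notation src := (@src V H).
Local Notation tgt := (@tgt V H).
Implicit Types (g m z d : vec).

Lemma dotvDr g m z : dotv g (m + z) = dotv g m + dotv g z.
Proof. by rewrite -big_split; apply: eq_bigr => c _; rewrite !ffunE mulrDr. Qed.

Lemma dotvZr g a m : dotv g (a *: m) = a * dotv g m.
Proof.
by rewrite /dotv mulr_sumr; apply: eq_bigr => c _; rewrite !ffunE mulrCA.
Qed.

Lemma local_polytope_segment m z (t : R) :
  local_polytope m -> local_polytope z -> 0 <= t -> t <= 1 ->
  local_polytope (m + t *: (z - m)).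
Proof.
move=> [m0 m1 mt ms] [z0 z1 zt zs] t0 t1.
have E c : (m + t *: (z - m)) c = (1 - t) * m c + t * z c.
  by rewrite !ffunE /GRing.scale /=; ring.
split=> [c|u|e y|e x].
- by rewrite E addr_ge0 ?mulr_ge0 ?subr_ge0.
- by under eq_bigr do rewrite E; rewrite big_split /= -!mulr_sumr m1 z1; ring.
- by under eq_bigr do rewrite E; rewrite big_split /= -!mulr_sumr mt zt E.
- by under eq_bigr do rewrite E; rewrite big_split /= -!mulr_sumr ms zs E.
Qed.

(* By convexity the slope of the objective at an interior point of the segment
   is at least the slope of the chord from the minimizer, which is nonnegative. *)
Lemma argmin_slope_ge0 g m z (t : R) : is_tree H ->
    is_argmin (@local_polytope R k V H) (fun z => dotv g z + phi z) m ->
    local_polytope z -> (forall c, 0 < m c \/ 0 < z c) -> 0 < t -> t < 1 ->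
  0 <= dotv g (z - m) +
       \sum_c bethe_wt R c * ((z - m) c * ln (m c + t * (z - m) c)).
Proof.
move=> treeH [Lm minm] Lz mz0 t0 t1.
set d := z - m; pose mt := m + t *: d.
have Lmt : local_polytope mt by apply: local_polytope_segment => //; exact: ltW.
have mtE c : mt c = m c + t * d c by rewrite !ffunE.
have mt0 c : 0 < mt c.
  have -> : mt c = (1 - t) * m c + t * z c by rewrite mtE !ffunE /=; ring.
  have [m0 _ _ _] := Lm; have [z0 _ _ _] := Lz.
  case: (mz0 c) => h.
    by rewrite ltr_wpDr ?mulr_gt0 ?subr_gt0 // mulr_ge0 // ltW.
  by rewrite ltr_pwDr ?mulr_gt0 // mulr_ge0 // subr_ge0 ltW.
(* Nonnegativity of [bregman m mt] bounds the change of [phi] by [t] times its slope at [mt]; adding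
   minimality of [m] and dividing by [t] gives the claim. *)
have E : m - mt = (- t) *: d by rewrite /mt opprD addrA subrr sub0r scaleNr.
have := bregman_ge0 treeH Lm Lmt mt0; rewrite /bregman E dotvZr.
rewrite dotv_grad_phiE //; last 2 first.
- exact: polytopeB_consistent.
- by move=> u; exact: polytopeB_sum0.
under eq_bigr do rewrite mtE.
have := minm _ Lmt; rewrite dotvDr dotvZr.
set S := \sum_c _ => h1 h2.
rewrite -(pmulr_rge0 _ t0); lra.
Qed.

(* If [m] had zero components, the slope towards [z] would behave like
   [B * ln t] near [t = 0], where [B] is the Bethe-weighted mass that [z] puts
   on these components; [B] is positive because the graph is a tree. *)
Lemma argmin_gt0 g m z : is_tree H ->
    is_argmin (@local_polytope R k V H) (fun z => dotv g z + phi z) m ->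
    local_polytope z -> (forall c, 0 < z c) -> forall c, 0 < m c.
Proof.
move=> treeH minm Lz z0 c0; have [Lm _] := minm.
have [m0 _ mt ms] := Lm; have [_ _ zt zs] := Lz.
rewrite lt_def m0 andbT; apply/negP => /eqP mc0.
pose w c := z c * (m c == 0)%:R.
have w0 c : 0 <= w c by rewrite mulr_ge0 ?ler0n // ltW.
(* A zero node entry forces the edge entries below it to vanish, so [w] has the monotonicity that
   the forest bounds require. *)
have wle (e : edge H) x y c : m (ecomp e x y) <= m c ->
    z (ecomp e x y) * (m c == 0)%:R <= w (ecomp e x y).
  move=> le; rewrite ler_wpM2l ?(ltW (z0 _)) // ler_nat.
  case: eqP => // mc; rewrite mc in le.
  by rewrite (_ : _ == 0) // eq_le le m0.
have wn u : 0 <= nodesum w u by exact: sumr_ge0.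
have ws e : nodesum w (src e) <= edgesum w e.
  apply: ler_sum => x _; rewrite /w -zs mulr_suml; apply: ler_sum => y _.
  by apply: wle; case: (polytope_node_ge e x y Lm).
have wt e : nodesum w (tgt e) <= edgesum w e.
  rewrite /edgesum exchange_big; apply: ler_sum => y _.
  rewrite /w -zt mulr_suml; apply: ler_sum => x _.
  by apply: wle; case: (polytope_node_ge e x y Lm).
have [_ acH] := treeH.
have B0 : 0 < \sum_c bethe_wt R c * w c.
  have wc0 : 0 < w c0 by rewrite /w mc0 eqxx mulr1.
  apply: lt_le_trans wc0 _; case: c0 {mc0} => [[u x]|[e [x y]]].
    apply: le_trans (bethe_sum_ge_node u acH wn ws wt).
    by rewrite /nodesum (bigD1 x) //= lerDl sumr_ge0.
  apply: le_trans (bethe_sum_ge_edge e acH wn ws wt).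
  by rewrite /edgesum pair_bigA (bigD1 (x, y)) //= lerDl sumr_ge0.
pose d := z - m.
(* Where [m c = 0], [ln (t * z c)] splits as [ln t + ln (z c)]; the first part goes into [B * ln t],
   and only the constant second part enters [r]. *)
pose r c (t : R) := if m c == 0 then z c * ln (z c) else d c * ln (m c + t * d c).
pose f (t : R) := dotv g d + \sum_c bethe_wt R c * r c t.
have fc : {for 0, continuous f}.
  have rd c : is_derive (0 : R) 1 (fun t => bethe_wt R c * r c t)
      (if m c == 0 then 0 else bethe_wt R c * d c * (d c / m c)).
    rewrite /r; case: (eqVneq (m c) 0) => mc; first exact: is_derive_cst.
    have mcp : 0 < m c by rewrite lt_def mc m0.
    have := is_derive_ln_affine (d c) (bethe_wt R c * d c) mcp.
    by under eq_fun do rewrite -mulrA.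
  apply: continuousD; first exact: cst_continuous.
  exact: continuous_is_derive (is_derive_bigsum _ _ rd).
have [t [tp t1 tn]] := ln_dominates fc B0.
have mz0 c : 0 < m c \/ 0 < z c by right.
have := argmin_slope_ge0 treeH minm Lz mz0 tp t1; rewrite leNgt => /negP; apply.
apply: le_lt_trans tn; rewrite /f addrCA lerD2l mulr_suml -big_split /=.
apply: ler_sum => c _; rewrite /w /r; case: eqVneq => mc; last first.
  by rewrite mulr0 mulr0 mul0r add0r.
rewrite !ffunE mc add0r subr0 mulr1 lnM ?posrE // -mulrA -mulrDr.
by rewrite (mulrDr (z c)).
Qed.

(** Since [m] is positive, the slope inequality passes to the limit [t = 0]; [z0] is the interior
    point for [argmin_gt0]. *)
Lemma argmin_variational g m z z0 : is_tree H ->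
    is_argmin (@local_polytope R k V H) (fun z => dotv g z + phi z) m ->
    local_polytope z0 -> (forall c, 0 < z0 c) -> local_polytope z ->
  0 <= dotv (g + grad (@phi R k V H) m) (z - m).
Proof.
move=> treeH minm Lz0 z0p Lz; have [Lm _] := minm.
have m0 := argmin_gt0 treeH minm Lz0 z0p; pose d := z - m.
pose f (t : R) := dotv g d +
  \sum_c (bethe_wt R c * d c) * ln (m c + t * d c).
have fc : {for 0, continuous f}.
  apply: continuousD; first exact: cst_continuous.
  apply: (continuous_is_derive (is_derive_bigsum _ _ _)) => c.
  exact: is_derive_ln_affine.
have : 0 <= f 0.
  apply: (ge0_right_limit fc) => t t0 t1.
  have := argmin_slope_ge0 treeH minm Lz (fun c => or_introl (m0 c)) t0 t1.
  by rewrite /f; under eq_bigr do rewrite mulrA.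
have -> : dotv (g + grad (@phi R k V H) m) d =
    dotv g d + dotv (grad (@phi R k V H) m) d.
  by rewrite -big_split; apply: eq_bigr => c _; rewrite !ffunE mulrDl.
rewrite dotv_grad_phiE //; last 2 first.
- exact: polytopeB_consistent.
- by move=> u; exact: polytopeB_sum0.
by congr (_ <= _); congr (_ + _); apply: eq_bigr => c _; rewrite mul0r addr0 mulrA.
Qed.

End MirrorStep.

(** * Lyapunov analysis of the iteration *)

Section VectorIdentities.
Variables (R : realType) (k : nat) (V : finType) (H : graph V).
Implicit Types (l p z b r u v w : gvec R k H).

Lemma sqnorm_ge0 v : 0 <= sqnorm v.
Proof. by apply: sumr_ge0 => c _; exact: sqr_ge0. Qed.

Lemma sqnormZ a v : sqnorm (a *: v) = a ^+ 2 * sqnorm v.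
Proof.
by rewrite /sqnorm mulr_sumr; apply: eq_bigr => c _; rewrite !ffunE exprMn.
Qed.

Lemma dotvDl u v w : dotv (u + v) w = dotv u w + dotv v w.
Proof. by rewrite -big_split; apply: eq_bigr => c _; rewrite !ffunE mulrDl. Qed.

Lemma dotvZl a u v : dotv (a *: u) v = a * dotv u v.
Proof.
by rewrite /dotv mulr_sumr; apply: eq_bigr => c _; rewrite !ffunE /= mulrA.
Qed.

Lemma dotvC u v : dotv u v = dotv v u.
Proof. by apply: eq_bigr => c _; rewrite mulrC. Qed.

(** The consensus objective along a line; its linear coefficient involves the updated multiplier. *)
Lemma augmented_shift (beta s : R) l v p b :
  - dotv l (p + s *: b) + beta / 2 * sqnorm (v - (p + s *: b)) =
  - dotv l p + beta / 2 * sqnorm (v - p)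
  - s * dotv (l + beta *: (v - p)) b + s ^+ 2 * (beta / 2 * sqnorm b).
Proof.
rewrite /dotv /sqnorm !mulr_sumr -!sumrN -!big_split /=; apply: eq_bigr => c _.
by rewrite !ffunE /GRing.scale /=; field.
Qed.

Lemma sqnorm_multiplier_step (beta : R) l r : beta != 0 ->
  (2 * beta)^-1 * sqnorm l - (2 * beta)^-1 * sqnorm (l + beta *: r) =
  - dotv l r - beta / 2 * sqnorm r.
Proof.
move=> b0; rewrite /dotv /sqnorm !mulr_sumr -!sumrN -!big_split /=.
by apply: eq_bigr => c _; rewrite !ffunE /GRing.scale /=; field.
Qed.

(* The last parenthesis on the left pairs multipliers and residuals with
   consensus directions, so it vanishes once summed over all trees. *)
Lemma primal_dual_split (beta : R) l u v p q z :
  - dotv l (v - z) - beta * dotv (u - p) (v - z)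
  + (beta / 2 * sqnorm (q - p) + beta / 2 * sqnorm (u - p))
  + (beta * dotv (v - q) (q - p) - beta * dotv (u - p) (q - p)
     + dotv l (q - z) + beta * dotv (u - p) (q - z)) =
  - dotv l (v - q) - beta / 2 * sqnorm (v - q) + beta / 2 * sqnorm (v - u).
Proof.
rewrite /dotv /sqnorm !mulr_sumr -!sumrN -!big_split /=.
by apply: eq_bigr => c _; rewrite !ffunE /=; field.
Qed.

Lemma bregman_three_points z u v :
  bregman z u - bregman z v - bregman v u =
  dotv (grad (@phi R k V H) v) (z - v) - dotv (grad (@phi R k V H) u) (z - v).
Proof.
rewrite /bregman; set g := grad _ u; set h := grad _ v.
have : dotv g (z - v) = dotv g (z - u) - dotv g (v - u).
  rewrite -sumrB; apply: eq_bigr => c _; rewrite !ffunE; ring.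
by move=> ->; ring.
Qed.

Lemma uniform_marg_gt0 c : 0 < uniform_marg R k H c.
Proof.
rewrite ffunE; case: c => [[_ x]|[_ [x _]]]; have k0 := leq_ltn_trans (leq0n x) (ltn_ord x).
  by rewrite invr_gt0 ltr0n.
by rewrite invr_gt0 exprn_gt0 // ltr0n.
Qed.

End VectorIdentities.

Lemma restr_local_polytope (R : realType) k (V : finType) (H G : graph V)
    (sHG : subgraph H G) (mu : gvec R k G) :
  local_polytope mu -> local_polytope (restr sHG mu).
Proof.
move=> [mu0 mu1 mut mus]; split=> [c|u|e y|e x]; rewrite ?ffunE //.
- by under eq_bigr do rewrite ffunE; exact: mu1.
- under eq_bigr do rewrite ffunE; rewrite /= mut; congr (mu (ncomp _ _)).
  exact/val_inj.
- under eq_bigr do rewrite ffunE; rewrite /= mus; congr (mu (ncomp _ _)).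
  exact/val_inj.
Qed.

Lemma quadratic_ge0_linear0 (R : realFieldType) (X Y : R) :
  (forall s, 0 <= s ^+ 2 * Y - s * X) -> 0 <= Y -> X = 0.
Proof.
move=> h Y0; have Y1 : Y + 1 != 0 by rewrite gt_eqF // ltr_wpDl.
(* At this value the quadratic equals [- s ^+ 2]; the shift by 1 keeps the quotient meaningful when
   [Y = 0]. *)
have := h (X / (Y + 1)).
have -> : (X / (Y + 1)) ^+ 2 * Y - X / (Y + 1) * X = - (X / (Y + 1)) ^+ 2 by field.
rewrite oppr_ge0 => le0.
have : (X / (Y + 1)) ^+ 2 == 0 by rewrite eq_le le0 sqr_ge0.
by rewrite sqrf_eq0 mulf_eq0 invr_eq0 (negbTE Y1) orbF => /eqP.
Qed.

(** * Orthogonality, one-step decrease and averaging along the iterates *)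

Section Convergence.
Variables (R : realType) (k : nat) (V : finType) (G : graph V).
Variables (TT : tree_family G) (rho : tree_index TT -> R) (theta : treevec R k TT).
Variables (alpha beta : R) (m : nat -> treevec R k TT) (mu : nat -> gvec R k G).
Variable lam : nat -> treevec R k TT.
Hypotheses (alpha_gt0 : 0 < alpha) (beta_gt0 : 0 < beta).
Hypothesis admm : bethe_admm rho theta alpha beta m mu lam.
Hypothesis m0_unif : forall i : tree_index TT, m 0%N i = uniform_marg R k (tree i).
Hypothesis mu0_unif : forall i : tree_index TT, tree_restr (mu 0%N) i = uniform_marg R k (tree i).
Hypothesis lam0 : forall i : tree_index TT, lam 0%N i = 0.
Hypothesis alpha_ge : forall i : tree_index TT,
  beta * (2 * #|vset (tree i)|%:R - 1) ^+ 2 <= alpha.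

Let resid t i := m t i - tree_restr (mu t) i.

Lemma tree_restrD (w z : gvec R k G) (i : tree_index TT) :
  tree_restr (w + z) i = tree_restr w i + tree_restr z i.
Proof. by apply/ffunP => c; rewrite !ffunE. Qed.

Lemma tree_restrN (w : gvec R k G) (i : tree_index TT) :
  tree_restr (- w) i = - tree_restr w i.
Proof. by apply/ffunP => c; rewrite !ffunE. Qed.

Lemma tree_restrZ a (w : gvec R k G) (i : tree_index TT) :
  tree_restr (a *: w) i = a *: tree_restr w i.
Proof. by apply/ffunP => c; rewrite !ffunE. Qed.

(** First-order optimality of the unconstrained consensus step; at time 0 the multipliers vanish. *)
Lemma multipliers_orth t (w : gvec R k G) :
  \sum_i dotv (lam t i) (tree_restr w i) = 0.
Proof.
case: t => [|t].
  by apply: big1 => i _; rewrite lam0; apply: big1 => c _; rewrite ffunE mul0r.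
have [_ minmu] := admm_mu admm t.
apply: (@quadratic_ge0_linear0 R _
    (\sum_i beta / 2 * sqnorm (tree_restr w i))); last first.
  by apply: sumr_ge0 => i _; rewrite !mulr_ge0 ?sqnorm_ge0 ?invr_ge0 // ltW.
move=> s; have := minmu (mu t.+1 + s *: w) I.
under [X in _ <= X -> _]eq_bigr => i _ do
  rewrite tree_restrD tree_restrZ augmented_shift -(admm_lam admm).
rewrite [X in _ <= X -> _]big_split [X in _ <= X + _ -> _]sumrB /= -!mulr_sumr; lra.
Qed.

(** A residual is a difference of successive multipliers divided by [beta]; at time 0 it vanishes
    because both initial points are uniform. *)
Lemma resid_orth t (w : gvec R k G) :
  \sum_i dotv (resid t i) (tree_restr w i) = 0.
Proof.
case: t => [|t].
  apply: big1 => i _; rewrite /resid m0_unif mu0_unif subrr.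
  by apply: big1 => c _; rewrite ffunE mul0r.
have := multipliers_orth t.+1 w.
under eq_bigr do rewrite (admm_lam admm) dotvDl dotvZl.
rewrite big_split /= multipliers_orth add0r -mulr_sumr => /eqP.
by rewrite mulf_eq0 gt_eqF //= => /eqP.
Qed.

Lemma iterate_polytope t i : local_polytope (m t i).
Proof. by case: t => [|t]; [exact: admm_init admm i|case: (admm_m admm t i)]. Qed.

(** By induction, the previous iterate is the interior point for [argmin_gt0]. *)
Lemma iterate_gt0 t i c : 0 < m t i c.
Proof.
elim: t c => [|t IHt] c; first by rewrite m0_unif uniform_marg_gt0.
exact: (argmin_gt0 (tree_tree i) (admm_m admm t i) (iterate_polytope t i) IHt).
Qed.

Variable z : gvec R k G.
Hypothesis Lz : local_polytope z.
Local Notation zr := (tree_restr z).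

Lemma mirror_step t i :
  dotv (rho i *: theta i + lam t i + beta *: resid t i) (m t.+1 i - zr i) <=
  alpha * (bregman (zr i) (m t i) - bregman (zr i) (m t.+1 i)
           - bregman (m t.+1 i) (m t i)).
Proof.
set y := _ + _ + _.
have Lzi : local_polytope (zr i) by exact: restr_local_polytope.
have := argmin_variational (tree_tree i) (admm_m admm t i) (iterate_polytope t i)
  (@iterate_gt0 t i) Lzi.
rewrite bregman_three_points -/y; set g := grad _ (m t i); set h := grad _ _.
clearbody y g h.
have -> : alpha^-1 *: y - g + h = alpha^-1 *: y + (h - g).
  by rewrite -addrA (addrC _ h).
have -> : dotv y (m t.+1 i - zr i) = - dotv y (zr i - m t.+1 i).
  by rewrite -sumrN; apply: eq_bigr => c _; rewrite !ffunE -mulrN opprB.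
rewrite dotvDl dotvZl dotvDl -[- g]scaleN1r dotvZl mulN1r => var.
rewrite -subr_ge0 opprK -(pmulr_rge0 _ (_ : 0 < alpha^-1)) ?invr_gt0 //.
by rewrite mulrDr mulrA mulVf ?gt_eqF // mul1r; lra.
Qed.

(** With [n = 2 * #|V| - 1 >= 1], [sqnorm_le_bregman] costs a factor [n], and
    [alpha >= beta * n ^+ 2 >= beta * n] pays for it. *)
Lemma bregman_step_ge t i :
  beta / 2 * sqnorm (m t.+1 i - m t i) <= alpha * bregman (m t.+1 i) (m t i).
Proof.
have Lm := iterate_polytope t i; have Lm' := iterate_polytope t.+1 i.
have treei := tree_tree i.
have B0 := bregman_ge0 treei Lm' Lm (@iterate_gt0 t i).
have := sqnorm_le_bregman treei Lm' Lm (@iterate_gt0 t i).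
set S := sqnorm _ => leS; set B := bregman _ _ in B0 leS *.
apply: le_trans (ler_wpM2r B0 (alpha_ge i)).
set n := 2 * _ - 1 in leS *.
have n1 : 1 <= n.
  have [[/set0Pn[u uH] _] _] := treei.
  have : (1 <= #|vset (tree i)|)%N by apply/card_gt0P; exists u.
  by rewrite -(ler_nat R) /n; lra.
rewrite -!mulrA ler_wpM2l ?(ltW beta_gt0) //; apply: le_trans leS _.
by rewrite ler_peMl // mulr_ge0 // (le_trans _ n1).
Qed.

Definition energy t i : R :=
  (2 * beta)^-1 * sqnorm (lam t i) + alpha * bregman (zr i) (m t i).

Lemma energy_step t :
  \sum_i rho i * dotv (m t.+1 i - zr i) (theta i) <=
  \sum_i energy t i - \sum_i energy t.+1 i.
Proof.
(* This sum is zero only over all trees together; adding it to the left side lets the inequality be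
   checked tree by tree. *)
have orth : \sum_i (beta * dotv (resid t.+1 i) (tree_restr (mu t.+1 - mu t) i)
    - beta * dotv (resid t i) (tree_restr (mu t.+1 - mu t) i)
    + dotv (lam t i) (tree_restr (mu t.+1 - z) i)
    + beta * dotv (resid t i) (tree_restr (mu t.+1 - z) i)) = 0.
  rewrite 2!big_split sumrB /= -!mulr_sumr multipliers_orth !resid_orth.
  by rewrite !mulr0 subrr !addr0.
rewrite -[leLHS]addr0 -[X in _ + X <= _]orth -big_split -sumrB /=; apply: ler_sum => i _.
rewrite !tree_restrD !tree_restrN /energy.
have step := mirror_step t i; rewrite 2!dotvDl 2!dotvZl (dotvC (theta i)) in step.
have := bregman_step_ge t i.
have := primal_dual_split beta (lam t i) (m t i) (m t.+1 i)
  (tree_restr (mu t) i) (tree_restr (mu t.+1) i) (zr i).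
have := sqnorm_multiplier_step (lam t i) (resid t.+1 i) (lt0r_neq0 beta_gt0).
rewrite -(admm_lam admm).
have : 0 <= beta / 2 * sqnorm (tree_restr (mu t.+1) i - tree_restr (mu t) i).
  by rewrite !mulr_ge0 ?sqnorm_ge0 ?invr_ge0 ?(ltW beta_gt0).
have : 0 <= beta / 2 * sqnorm (resid t i).
  by rewrite !mulr_ge0 ?sqnorm_ge0 ?invr_ge0 ?(ltW beta_gt0).
rewrite /resid; lra.
Qed.

Lemma energy_sum T :
  \sum_(1 <= t < T.+1) \sum_i rho i * dotv (m t i - zr i) (theta i) <=
  \sum_i energy 0 i - \sum_i energy T i.
Proof.
elim: T => [|T IHT]; first by rewrite big_geq // subrr.
by rewrite big_nat_recr //=; have := energy_step T; lra.
Qed.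

Lemma multiplier_sum T i : lam T i = beta *: \sum_(1 <= t < T.+1) resid t i.
Proof.
elim: T => [|T IHT]; first by rewrite big_geq // scaler0 lam0.
by rewrite big_nat_recr //= scalerDr -IHT (admm_lam admm).
Qed.

Lemma avg_resid T i :
  time_avg (fun t => m t i) T - time_avg (fun t => tree_restr (mu t) i) T =
  (T%:R * beta)^-1 *: lam T i.
Proof.
rewrite multiplier_sum scalerA invfM -mulrA mulVf ?gt_eqF // mulr1.
by rewrite -scalerBr -sumrB.
Qed.

Lemma avg_gap T i : (0 < T)%N ->
  dotv (time_avg (fun t => m t i) T - zr i) (theta i) =
  T%:R^-1 * \sum_(1 <= t < T.+1) dotv (m t i - zr i) (theta i).
Proof.
move=> T0; have Tn0 : T%:R != 0 :> R by rewrite pnatr_eq0 -lt0n.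
have -> : \sum_(1 <= t < T.+1) dotv (m t i - zr i) (theta i) =
    dotv (\sum_(1 <= t < T.+1) (m t i - zr i)) (theta i).
  elim/big_ind2 : _ => //; last by move=> ? ? ? ? -> ->; rewrite dotvDl.
  by rewrite /dotv big1 // => c _; rewrite ffunE mul0r.
rewrite -dotvZl; congr dotv; rewrite sumrB scalerBr; congr (_ - _).
rewrite sumr_const_nat subSS subn0.
by rewrite -[zr i *+ T]scaler_nat scalerA mulVf // scale1r.
Qed.

End Convergence.

Theorem theorem1 (R : realType) (k : nat) (V : finType) (G : graph V)
    (TT : tree_family G) (f : gvec R k G)
    (rho : tree_index TT -> R) (theta : treevec R k TT)
    (rho_gt0 : forall i : tree_index TT, 0 < rho i)
    (split : potential_split f rho theta)
    (alpha beta : R) (alpha_gt0 : 0 < alpha) (beta_gt0 : 0 < beta)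
    (m : nat -> treevec R k TT) (mu : nat -> gvec R k G)
    (lam : nat -> treevec R k TT)
    (admm : bethe_admm rho theta alpha beta m mu lam)
    (mustar : gvec R k G) (mustar_opt : lp_optimal f mustar)
    (m0_unif : forall i : tree_index TT, m 0%N i = uniform_marg R k (tree i))
    (mu0_unif : forall i : tree_index TT,
        tree_restr (mu 0%N) i = uniform_marg R k (tree i))
    (lam0 : forall i : tree_index TT, lam 0%N i = 0)
    (Dmu : R)
    (Dmu_max : is_max (fun i : tree_index TT =>
        bregman (tree_restr mustar i) (m 0%N i)) Dmu)
    (alpha_ge : forall i : tree_index TT,
       beta * (2 * #|vset (tree i)|%:R - 1) ^+ 2 <= alpha)
    (T : nat) (T_ge1 : (1 <= T)%N) :
  \sum_(i : tree_index TT)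
     (rho i * dotv (time_avg (fun t => m t i) T - tree_restr mustar i)
                   (theta i)
      + beta / 2 * sqnorm (time_avg (fun t => m t i) T
                           - time_avg (fun t => tree_restr (mu t) i) T))
  <= Dmu * alpha * #|tree_index TT|%:R / T%:R.
Proof.
have Lz := proj1 mustar_opt.
have T0 : 0 < T%:R :> R by rewrite ltr0n.
have T1 : T%:R^-1 <= 1 :> R by rewrite invf_le1 // ler1n.
pose E t i := energy alpha beta m lam mustar t i.
(* The quadratic term is [T ^- 2] times the multiplier part of [E T i]; one factor [1 / T] is
   bounded by 1, and the divergence part of [E T i] is nonnegative. *)
have gap (i : tree_index TT) :
    rho i * dotv (time_avg (fun t => m t i) T - tree_restr mustar i) (theta i)
    + beta / 2 * sqnorm (time_avg (fun t => m t i) T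
                         - time_avg (fun t => tree_restr (mu t) i) T)
    <= T%:R^-1 * (\sum_(1 <= t < T.+1)
         rho i * dotv (m t i - tree_restr mustar i) (theta i) + E T i).
  rewrite avg_gap // (avg_resid beta_gt0 admm lam0) sqnormZ -mulr_sumr mulrDr.
  rewrite mulrCA lerD2l.
  have -> : beta / 2 * ((T%:R * beta)^-1 ^+ 2 * sqnorm (lam T i)) =
      T%:R^-1 * (T%:R^-1 * ((2 * beta)^-1 * sqnorm (lam T i))).
    by field; rewrite !gt_eqF.
  have S0 : 0 <= (2 * beta)^-1 * sqnorm (lam T i).
    by rewrite mulr_ge0 ?sqnorm_ge0 // invr_ge0 mulr_ge0 // ltW.
  rewrite ler_wpM2l ?invr_ge0 ?(ltW T0) //; apply: (@le_trans _ _ _ _ _ (ler_piMl S0 T1)).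
  rewrite lerDl mulr_ge0 ?(ltW alpha_gt0) // (bregman_ge0 (tree_tree i)) //.
  - exact: restr_local_polytope.
  - exact: iterate_polytope admm T i.
  - exact: iterate_gt0 admm m0_unif T i.
apply: le_trans (ler_sum _ (fun i _ => gap i)) _.
rewrite -mulr_sumr mulrC ler_pdivlMr // divfK ?gt_eqF //.
rewrite big_split exchange_big /=.
(* The final energies added in [gap] cancel against those subtracted here, leaving the initial
   energy, which is pure divergence as [lam 0 = 0]. *)
have := energy_sum alpha_gt0 beta_gt0 admm m0_unif mu0_unif lam0 alpha_ge Lz T.
rewrite lerBrDr => /le_trans; apply.
have [_ Dge] := Dmu_max.
apply: (@le_trans _ _ (\sum_(i : tree_index TT) Dmu * alpha)); last first.
  by rewrite sumr_const mulr_natr.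
apply: ler_sum => i _; rewrite /energy lam0.
have -> : sqnorm (0 : gvec R k (tree i)) = 0.
  by apply: big1 => c _; rewrite ffunE expr0n.
by rewrite mulr0 add0r mulrC ler_wpM2r ?(ltW alpha_gt0) // Dge.
Qed.
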